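(* Let $\Delta$ and $\Delta'$ be fully exposed simplicial complexes on $[n]$. If $\sigma\cdot\mathcal R(\Delta)=\mathcal R(\Delta')$ for some permutation $\sigma\in S_n$ acting on $\mathbb Z^n$ by permuting coordinates (so $\sigma\cdot\mathbf e_i=\mathbf e_{\sigma(i)}$), then $\sigma\cdot\Delta=\Delta'$, where $\sigma\cdot\Delta=\{\sigma(A):A\in\Delta\}$; in particular $\Delta\cong\Delta'$ as abstract simplicial complexes.
   Context: For $n\ge 1$, $[n]=\{1,\dots,n\}$. A simplicial complex $\Delta$ on $[n]$ is a collection of subsets of $[n]$ (faces) closed under taking subsets; it is always assumed that $\{i\}\in\Delta$ for every $i\in[n]$. Facets are the inclusion-maximal faces; $\mathcal F(\Delta)$ is the set of facets, and $\mathcal F_\sigma(\Delta)=\{F\in\mathcal F(\Delta):\sigma\subseteq F\}$ for $\sigma\subseteq[n]$. For a face $S$, $\operatorname{cl}(S)=\bigcap_{F\in\mathcal F_S(\Delta)}F$. For $i\in[n]$, $\mathcal A_i(\Delta)=\{S\subseteq[n]\setminus\{i\}: S\in\Delta,\ i\in\operatorname{cl}(S)\}$. A facet $F$ is exposed if there exist $i\in[n]$ and $S\in\mathcal A_i(\Delta)$ with $S\subseteq F$. $\Delta$ is fully exposed if every facet is exposed. $\mathbf e_i$ is the $i$-th standard basis vector of $\mathbb Z^n$ and $\operatorname{supp}(a)=\{i:a_i\ne0\}$. The set of Demazure roots of $\Delta$ is $$\mathcal R(\Delta)=\{\beta-\mathbf e_i: i\in[n],\ \beta\in\mathbb Z^n_{\ge0},\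 \beta_i=0,\ \operatorname{supp}(\beta)\in\mathcal A_i(\Delta)\}\subseteq\mathbb Z^n .$$ *)

(* Defs.v *)
From mathcomp Require Import all_boot all_order all_algebra all_fingroup.
From mathcomp Require Import classical_sets.

Set Implicit Arguments.
Unset Strict Implicit.
Unset Printing Implicit Defensive.

Import GRing.Theory Num.Theory.
Local Open Scope ring_scope.

(* The vertex set [n] = {1, ..., n} is represented by 'I_n = {0, ..., n-1}. *)

Definition simplicial_complex (n : nat) (D : {set {set 'I_n}}) : Prop :=
  (forall A B : {set 'I_n}, A \in D -> B \subset A -> B \in D)
  /\ (forall i : 'I_n, [set i] \in D).

Definition facets (n : nat) (D : {set {set 'I_n}}) : {set {set 'I_n}} :=
  [set F | maxset (fun A => A \in D) F].

Definition facets_containing (n : nat) (D : {set {set 'I_n}}) (S : {set 'I_n}) :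
    {set {set 'I_n}} :=
  [set F in facets D | S \subset F].

Definition cl (n : nat) (D : {set {set 'I_n}}) (S : {set 'I_n}) : {set 'I_n} :=
  \bigcap_(F in facets_containing D S) F.

(* The family written A_i(D). *)
Definition forcing_faces (n : nat) (D : {set {set 'I_n}}) (i : 'I_n) :
    {set {set 'I_n}} :=
  [set S : {set 'I_n} | [&& S \subset [set~ i], S \in D & i \in cl D S]].

Definition exposed (n : nat) (D : {set {set 'I_n}}) (F : {set 'I_n}) : Prop :=
  exists i : 'I_n, exists2 S, S \in forcing_faces D i & S \subset F.

Definition fully_exposed (n : nat) (D : {set {set 'I_n}}) : Prop :=
  forall F, F \in facets D -> exposed D F.

Definition std_basis (n : nat) (i : 'I_n) : 'rV[int]_n := delta_mx 0 i.

Definition supp (n : nat) (a : 'rV[int]_n) : {set 'I_n} :=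
  [set i | a 0 i != 0].

Definition demazure_roots (n : nat) (D : {set {set 'I_n}}) : set 'rV[int]_n :=
  [set a | exists (i : 'I_n) (b : 'rV[int]_n),
     [/\ forall j, 0 <= b 0 j,
         b 0 i = 0,
         supp b \in forcing_faces D i
       & a = b - std_basis i]]%classic.

(* The inverse makes this the action sending e_i to e_(s i); see
   perm_act_std_basis. *)
Definition perm_act (n : nat) (s : 'S_n) (a : 'rV[int]_n) : 'rV[int]_n :=
  col_perm s^-1%g a.

Lemma perm_act_std_basis (n : nat) (s : 'S_n) (i : 'I_n) :
  perm_act s (std_basis i) = std_basis (s i).
Proof.
apply/rowP => j; rewrite !mxE eqxx /=.
by rewrite (canF_eq (permKV s)).
Qed.

Definition perm_complex (n : nat) (s : 'S_n) (D : {set {set 'I_n}}) :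
    {set {set 'I_n}} :=
  [set s @: A | A : {set 'I_n} in D].

(* Every element of 'I_n is a vertex of a simplicial_complex, so a bijection
   between vertex sets is a bijection between the ambient types. *)
Definition isomorphic_complexes (m n : nat)
    (D : {set {set 'I_m}}) (D' : {set {set 'I_n}}) : Prop :=
  exists2 f : 'I_m -> 'I_n, bijective f &
    forall A : {set 'I_m}, (A \in D) = (f @: A \in D').

(* Main.v *)
Require Import Defs.
From mathcomp Require Import all_boot all_order all_algebra all_fingroup.
From mathcomp Require Import classical_sets.

(** A fully exposed complex can be read off from its Demazure roots, in two
    steps.

    First, the roots determine the forcing faces.  A root [b - e_i] has a single
    negative coordinate, at [i], so both [i] and [b] are recovered from it; hence
    [S] is a forcing face of [i] exactly when the indicator vector of [S] minus
    [e_i] is a root ([mem_demazure_roots_indicator]).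

    Secondly, the forcing faces determine the complex.  If [S] is a forcing face
    of [i], then every facet above [S] contains [i], so [i |: S] is a face
    ([forcing_face_setU1]).  In a fully exposed complex every facet [F] has this
    form: if [S \subset F] is a forcing face of [i], then [i] lies in [F], and
    [F :\ i], being larger than [S], is again a forcing face of [i]
    ([exposed_facet_setD1]).  So the faces are precisely the subsets of the sets
    [i |: S].

    Since indicator vectors and basis vectors are permuted along with the
    vertices, an inclusion of permuted root sets gives an inclusion of permuted
    complexes ([face_of_demazure_rootsS]); the theorem applies this to [s] and to
    its inverse. *)

Set Implicit Arguments.
Unset Strict Implicit.
Unset Printing Implicit Defensive.

Import GRing.Theory Num.Theory.
Local Open Scope ring_scope.

Lemma forcing_facesP n (D : {set {set 'I_n}}) (S : {set 'I_n}) (i : 'I_n) :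
  reflect [/\ i \notin S, S \in D
            & forall F, F \in facets D -> S \subset F -> i \in F]
          (S \in forcing_faces D i).
Proof.
rewrite inE finset.subsetC finset.sub1set inE.
apply: (iffP and3P) => -[iS SD iF]; split=> //.
  by move=> F FD SF; apply: (bigcapP iF); rewrite inE FD.
by apply/bigcapP => F; rewrite inE => /andP[]; apply: iF.
Qed.

Lemma face_sub_facet n (D : {set {set 'I_n}}) (A : {set 'I_n}) :
  A \in D -> exists2 F, F \in facets D & A \subset F.
Proof.
move=> AD; have [F maxF AF] := @maxset_exists _ (fun B => B \in D) A AD.
by exists F; rewrite ?inE.
Qed.

Lemma facet_face n (D : {set {set 'I_n}}) (F : {set 'I_n}) :
  F \in facets D -> F \in D.
Proof. by rewrite inE => /maxsetp. Qed.

(** Any facet above [S] contains both [S] and [i]. *)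
Lemma forcing_face_setU1 n (D : {set {set 'I_n}}) (S : {set 'I_n}) (i : 'I_n) :
  simplicial_complex D -> S \in forcing_faces D i -> i |: S \in D.
Proof.
move=> [downD _] /forcing_facesP[_ SD iF].
have [F FD SF] := face_sub_facet SD.
by apply: downD (facet_face FD) _; rewrite finset.subUset finset.sub1set iF.
Qed.

(** Being a forcing face of [i] passes to larger faces that avoid [i], since fewer
    facets lie above them; [F :\ i] is the largest such face inside [F]. *)
Lemma exposed_facet_setD1 n (D : {set {set 'I_n}}) (F : {set 'I_n}) :
    simplicial_complex D -> F \in facets D -> exposed D F ->
  exists2 i, i \in F & F :\ i \in forcing_faces D i.
Proof.
move=> [downD _] FD [i [S /forcing_facesP[iS SD iF] SF]].
exists i; first exact: iF.
apply/forcing_facesP; split; first by rewrite !inE eqxx.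
  by apply: downD (facet_face FD) _; apply: finset.subD1set.
move=> G GD FG; apply: iF => //; apply: fintype.subset_trans FG.
by rewrite finset.subsetD1 SF.
Qed.

Definition indicator n (S : {set 'I_n}) : 'rV[int]_n := \row_j (j \in S)%:R.

Lemma supp_indicator n (S : {set 'I_n}) : supp (indicator S) = S.
Proof. by apply/setP => j; rewrite inE mxE; case: (j \in S). Qed.

(** The hypothesis [i \notin S] is what makes coordinate [i] of the vector
    negative, so that it identifies the index of any expression of the vector
    as a root. *)
Lemma mem_demazure_roots_indicator n (D : {set {set 'I_n}})
    (S : {set 'I_n}) (i : 'I_n) : i \notin S ->
  demazure_roots D (indicator S - std_basis i) <-> S \in forcing_faces D i.
Proof.
move=> iS; split=> [[k [b [b_ge0 _ bD E]]]|SD]; last first.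
  exists i, (indicator S); split; rewrite ?supp_indicator //.
    by move=> j; rewrite mxE ler0n.
  by rewrite mxE (negPf iS).
have [Eki|ki] := eqVneq k i.
  by move: E bD; rewrite Eki => /addIr <-; rewrite supp_indicator.
have /rowP/(_ i) := E; rewrite !mxE (negPf iS) !eqxx (eq_sym i k) (negPf ki) /=.
by move=> Ei; have := b_ge0 i; rewrite subr0 in Ei; rewrite -Ei.
Qed.

Lemma perm_act_indicator n (s : 'S_n) (S : {set 'I_n}) :
  perm_act s (indicator S) = indicator (s @: S).
Proof.
apply/rowP => j; rewrite !mxE -{2}(permKV s j) mem_imset //.
exact: perm_inj.
Qed.

Lemma perm_actB n (s : 'S_n) : {morph @perm_act n s : a b / a - b}.
Proof. by move=> a b; apply/rowP => j; rewrite !mxE. Qed.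

Lemma perm_actK n (s : 'S_n) : cancel (@perm_act n s) (perm_act s^-1%g).
Proof. by move=> a; apply/rowP => j; rewrite !mxE invgK permK. Qed.

(** Enlarge the face to a facet [F] and write [F = i |: (F :\ i)] with [F :\ i] a
    forcing face of [i]: the permutation carries the corresponding root to a
    root of [D'], which makes [s @: F] a face of [D']. *)
Lemma face_of_demazure_rootsS n (D D' : {set {set 'I_n}}) (s : 'S_n)
    (A : {set 'I_n}) :
    simplicial_complex D -> simplicial_complex D' -> fully_exposed D ->
    (perm_act s @` demazure_roots D `<=` demazure_roots D')%classic ->
  A \in D -> s @: A \in D'.
Proof.
move=> complexD complexD' exposedD rootsS AD.
have [F FD AF] := face_sub_facet AD.
have [i iF FiD] := exposed_facet_setD1 complexD FD (exposedD F FD).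
have iFi : i \notin F :\ i by rewrite !inE eqxx.
have FiD' : s @: (F :\ i) \in forcing_faces D' (s i).
  apply/mem_demazure_roots_indicator.
    by rewrite mem_imset //; apply: perm_inj.
  rewrite -perm_act_indicator -perm_act_std_basis -perm_actB.
  by apply: rootsS; exists (indicator (F :\ i) - std_basis i) => //; apply/mem_demazure_roots_indicator.
have := forcing_face_setU1 complexD' FiD'.
rewrite -finset.imsetU1 finset.setD1K // => FD'.
by case: complexD' => downD' _; apply: downD' FD' _; apply: finset.imsetS.
Qed.

Theorem mainTheorem2 (n : nat) (n_gt0 : (0 < n)%N)
    (D D' : {set {set 'I_n}})
    (complexD : simplicial_complex D) (complexD' : simplicial_complex D')
    (exposedD : fully_exposed D) (exposedD' : fully_exposed D')
    (s : 'S_n)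
    (rootsE : (perm_act s @` demazure_roots D)%classic = demazure_roots D') :
  perm_complex s D = D' /\ isomorphic_complexes D D'.
Proof.
have imK (t : 'S_n) (A : {set 'I_n}) : t^-1%g @: (t @: A) = A.
  rewrite -finset.imset_comp -[RHS]finset.imset_id; apply: finset.eq_imset => i /=.
  exact: permK.
have sD A : A \in D -> s @: A \in D'.
  by apply: face_of_demazure_rootsS => //; rewrite rootsE.
have sVD' A : A \in D' -> s^-1%g @: A \in D.
  apply: face_of_demazure_rootsS => //.
  by rewrite -rootsE => _ [_ [a Ra <-] <-]; rewrite perm_actK.
split; last first.
  exists s => [|A]; first by exists s^-1%g; [apply: permK | apply: permKV].
  by apply/idP/idP => [/sD//|/sVD']; rewrite imK.
apply/setP => A; apply/imsetP/idP => [[B BD ->]|AD']; first exact: sD.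
by exists (s^-1%g @: A); rewrite ?sVD' // -{1}(invgK s) imK.
Qed.
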